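(* (i) For every integer $n\geq 2$, $\chi_d^t(F_n)=3$. (ii) For every integer $n\geq 2$, $\chi_d^t(D_4^n)=n+2$. (iii) For every integer $n\geq 2$, $\chi_d^t(D_5^n)=2n+2$.
   Context: All graphs are finite and simple. For a graph $G$ with no isolated vertex, a total dominator coloring (TD-coloring) of $G$ is a proper coloring of the vertices of $G$ in which each vertex of $G$ is adjacent to every vertex of some (nonempty) color class. The total dominator chromatic number $\chi_d^t(G)$ is the minimum number of color classes in a TD-coloring of $G$. The friendship graph $F_n$ is the graph obtained by coalescing $n$ copies of the cycle $C_3$ at one common vertex. The generalized friendship graph $D_q^n$ is the collection of $n$ cycles, all of order $q$, meeting at one common vertex (and otherwise disjoint). *)

(* Defs.v *)
From mathcomp Require Import all_boot.

Set Implicit Arguments.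
Unset Strict Implicit.
Unset Printing Implicit Defensive.

Record sgraph := SGraph {
  vertex :> finType;
  adj : rel vertex;
  adj_sym : symmetric adj;
  adj_irr : irreflexive adj
}.

Definition no_isolated (G : sgraph) : bool :=
  [forall x : G, exists y : G, adj x y].

Definition stable (G : sgraph) (S : {set G}) : bool :=
  [forall x in S, forall y in S, ~~ adj x y].

(* A coloring is represented by its set P of color classes; [partition]
   requires the classes to be nonempty, and #|P| is the number of classes. *)
Definition proper_coloring (G : sgraph) (P : {set {set G}}) : bool :=
  partition P [set: G] && [forall S in P, stable S].

Definition td_coloring (G : sgraph) (P : {set {set G}}) : bool :=
  proper_coloring P &&
  [forall x : G, exists S in P, [forall y in S, adj x y]].

Definition discrete_coloring (G : sgraph) : {set {set G}} :=
  [set [set x] | x in G].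

(* [discrete_coloring G] is a TD-coloring exactly when G has no isolated
   vertex; otherwise G has no TD-coloring at all and the value is junk.
   See [td_chromaticP]. *)
Definition td_chromatic (G : sgraph) : nat :=
  #|[arg min_(P < discrete_coloring G | td_coloring P) #|P|]|.

Lemma discrete_td_coloring (G : sgraph) :
  no_isolated G -> td_coloring (discrete_coloring G).
Proof.
move=> /forallP noG; apply/andP; split; first (apply/andP; split).
- apply/and3P; split.
  + apply/eqP/setP=> x; rewrite inE; apply/bigcupP.
    by exists [set x]; rewrite ?set11 // imset_f.
  + apply/trivIsetP=> _ _ /imsetP[x _ ->] /imsetP[y _ ->] xy.
    by rewrite disjoints1 inE; apply: contraNneq xy => ->.
  + by apply/imsetP=> -[x _ /setP/(_ x)]; rewrite !inE eqxx.
- apply/forall_inP=> _ /imsetP[z _ ->].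
  apply/forall_inP=> x /set1P->; apply/forall_inP=> y /set1P->.
  by rewrite adj_irr.
- apply/forallP=> x; have /existsP[y xy] := noG x.
  apply/exists_inP; exists [set y]; first by rewrite imset_f.
  by apply/forall_inP=> z /set1P->.
Qed.

Lemma td_chromaticP (G : sgraph) : no_isolated G ->
  (exists2 P : {set {set G}}, td_coloring P & #|P| = td_chromatic G) /\
  (forall P : {set {set G}}, td_coloring P -> td_chromatic G <= #|P|).
Proof.
move=> /discrete_td_coloring dG; rewrite /td_chromatic.
by case: arg_minnP => // P tdP minP; split; first exists P.
Qed.

Definition cycle_adj (q : nat) : rel 'I_q :=
  fun i j => (i != j) && ((j == i.+1 %% q :> nat) || (i == j.+1 %% q :> nat)).

Lemma cycle_adj_sym (q : nat) : symmetric (@cycle_adj q).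
Proof. by move=> i j; rewrite /cycle_adj eq_sym orbC. Qed.

Lemma cycle_adj_irr (q : nat) : irreflexive (@cycle_adj q).
Proof. by move=> i; rewrite /cycle_adj eqxx. Qed.

(* This is the cycle of order q only for 2 < q. *)
Definition cycle_graph (q : nat) : sgraph :=
  SGraph (@cycle_adj_sym q) (@cycle_adj_irr q).

(* Coalescence of n copies of G at the vertex r: [None] is the common vertex,
   and [Some (i, x)] is the vertex x != r of the i-th copy. *)
Definition coalescence_adj (n : nat) (G : sgraph) (r : G) :
    rel (option ('I_n * {x : G | x != r})) :=
  fun u v => match u, v with
  | None, None => false
  | None, Some (_, y) => adj r (val y)
  | Some (_, x), None => adj (val x) r
  | Some (i, x), Some (j, y) => (i == j) && adj (val x) (val y)
  end.

Lemma coalescence_adj_sym (n : nat) (G : sgraph) (r : G) :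
  symmetric (@coalescence_adj n G r).
Proof.
move=> [[i x]|] [[j y]|] //=; try exact: adj_sym.
by rewrite adj_sym eq_sym.
Qed.

Lemma coalescence_adj_irr (n : nat) (G : sgraph) (r : G) :
  irreflexive (@coalescence_adj n G r).
Proof. by move=> [[i x]|] //=; rewrite adj_irr andbF. Qed.

Definition coalescence (n : nat) (G : sgraph) (r : G) : sgraph :=
  SGraph (@coalescence_adj_sym n G r) (@coalescence_adj_irr n G r).

Definition friendship (n : nat) : sgraph :=
  coalescence n (ord0 : cycle_graph 3).

(* Meaningful for 2 < q, where q.-1.+1 = q; the successor form is what makes
   [ord0] available. *)
Definition gen_friendship (q n : nat) : sgraph :=
  coalescence n (ord0 : cycle_graph q.-1.+1).

Lemma no_isolated_cycle (q : nat) : 1 < q -> no_isolated (cycle_graph q).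
Proof.
move=> q1; have q0 : 0 < q by apply: ltnW.
apply/forallP=> i; apply/existsP; exists (Ordinal (ltn_pmod i.+1 q0)).
rewrite /= /cycle_adj /= eqxx andbT -val_eqE /=.
have := ltn_ord i; rewrite leq_eqVlt => /orP[/eqP Eq|lt_q].
  by rewrite [in X in _ != X]Eq modnn; apply/eqP=> i0; rewrite -Eq i0 in q1.
by rewrite modn_small // neq_ltn ltnSn.
Qed.

Lemma no_isolated_coalescence (n : nat) (G : sgraph) (r : G) :
  0 < n -> no_isolated G -> no_isolated (coalescence n r).
Proof.
move=> n0 /forallP noG; apply/forallP=> -[[i x]|]; apply/existsP.
- have /existsP[y xy] := noG (val x).
  have [yr|yr] := eqVneq y r; first by exists None; move: xy; rewrite yr.
  by exists (Some (i, exist _ y yr)); rewrite /= eqxx.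
- have /existsP[y ry] := noG r.
  have yr : y != r by apply: contraTneq ry => ->; rewrite adj_irr.
  by exists (Some (Ordinal n0, exist _ y yr)).
Qed.

Lemma no_isolated_friendship (n : nat) : 0 < n -> no_isolated (friendship n).
Proof. by move=> n0; apply/no_isolated_coalescence/no_isolated_cycle. Qed.

Lemma no_isolated_gen_friendship (q n : nat) :
  2 < q -> 0 < n -> no_isolated (gen_friendship q n).
Proof.
by case: q => // q q2 n0; apply/no_isolated_coalescence/no_isolated_cycle/ltnW.
Qed.

(* Main.v *)
Require Import Defs.
From mathcomp Require Import all_boot.

(** The upper bounds are explicit colorings.  Write h for the common vertex and
    number the other vertices of each cycle of order q+1 from 0 to q-1, so that
    each cycle is a path whose two ends are joined to h.  The class {h} serves
    all the neighbors of h.  For triangles, two further classes suffice, one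
    for each end.  For squares, the two ends of each path form a class, which
    serves the middle vertex, and one class takes all the middle vertices.  For
    pentagons, each path splits into the classes {0,2} and {1,3}, which serve 1
    and 2; only h is left without a class inside its neighborhood, and cutting
    one single {0,2} into {0} and {2} provides it.

    For the lower bounds, a triangle is a clique.  In the other two cases let X
    be the set of vertices not adjacent to h, other than h itself.  No two of
    them have a common neighbor, so the classes that they dominate are
    pairwise distinct; h has no neighbor in X, so the class C of h is one more.
    This gives #|X| + 1 classes, one short of the claim, and
    [open_packing_bound] says that one more exists unless C and the classes
    dominated by X are all the classes there are.

    Suppose they are.  Some vertex u of X then lies in C.  For squares every
    vertex of X does: no element of X is adjacent to it.  For pentagons, h
    dominates a class, which is not C and so is dominated by some x in X; the
    other element u of X on the cycle of x has x as its only neighbor in X, and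
    it is outside the class dominated by x because u is not adjacent to h;
    hence u lies in C.  Now take a neighbor a of h on a cycle other than that of
    u; here two cycles are needed.  The class that a dominates cannot be C,
    because a is not adjacent to u, so it is dominated by some x in X as well,
    and a and x have a common neighbor.  For squares that is absurd.  For
    pentagons x is at distance 2 from a on the same cycle, and the
    neighbor v of x other than that common one has x as its only neighbor in X
    and is not adjacent to a, so it lies in C; but v is adjacent to h. *)

Set Implicit Arguments.
Unset Strict Implicit.
Unset Printing Implicit Defensive.

(** * Total dominator colorings of arbitrary graphs *)

Section TotalDominatorColorings.

Variable G : sgraph.
Implicit Types (P : {set {set G}}) (S T X : {set G}) (x y z : G).

(** Colorings are easiest to write as functions.  A
    color that [f] misses only makes the coloring smaller, which the lower bound
    excludes. *)
Lemma td_chromatic_coloring (I : finType) (f : G -> I) :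
    no_isolated G ->
    (forall x y, adj x y -> f x != f y) ->
    (forall x, exists y, forall z, f z = f y -> adj x z) ->
    (forall P, td_coloring P -> #|I| <= #|P|) ->
  td_chromatic G = #|I|.
Proof.
move=> noG propf domf lowI; apply/eqP; rewrite eqn_leq.
have [[P tdP <-] minG] := td_chromaticP noG; rewrite lowI // andbT.
pose Q := preim_partition f [set: G].
have QE S : (S \in Q) -> exists2 x, x \in S & S = [set y | f x == f y].
  case/imsetP=> x _ ->; exists x; first by rewrite !inE eqxx.
  by apply/setP=> y; rewrite !inE.
apply: leq_trans (minG Q _) _.
- apply/andP; split; first (apply/andP; split).
  + exact: preim_partitionP.
  + apply/forall_inP=> _ /QE[x _ ->].
    apply/forall_inP=> y; rewrite inE => /eqP fxy.
    apply/forall_inP=> z; rewrite inE => /eqP fxz.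
    by apply/negP=> /propf; rewrite -fxy -fxz eqxx.
  + apply/forallP=> x; have [y xy] := domf x.
    apply/exists_inP; exists [set z | f y == f z].
      by apply/imsetP; exists y => //; apply/setP=> z; rewrite !inE.
    by apply/forall_inP=> z; rewrite inE => /eqP fyz; apply: xy.
- have sQ : Q \subset [set [set y | i == f y] | i : I].
    by apply/subsetP=> _ /QE[x _ ->]; apply: imset_f.
  exact: leq_trans (subset_leq_card sQ) (leq_imset_card _ _).
Qed.

Lemma same_class P S T x : proper_coloring P ->
  S \in P -> T \in P -> x \in S -> x \in T -> S = T.
Proof.
case/andP=> /and3P[_ tiP _] _ PS PT Sx Tx.
by rewrite -(def_pblock tiP PS Sx) (def_pblock tiP PT Tx).
Qed.

Lemma class_exists P x : proper_coloring P -> exists2 S, S \in P & x \in S.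
Proof.
case/andP=> /and3P[/eqP covP _ _] _; exists (pblock P x).
  by rewrite pblock_mem // covP.
by rewrite mem_pblock covP.
Qed.

Lemma class_nonempty P S : proper_coloring P -> S \in P -> exists x, x \in S.
Proof.
case/andP=> /and3P[_ _ P0] _ PS; apply/set0Pn.
by apply: contraNneq P0 => <-.
Qed.

Lemma class_stable P S x y : proper_coloring P ->
  S \in P -> x \in S -> y \in S -> ~~ adj x y.
Proof.
by case/andP=> _ /forall_inP stP /stP/forall_inP stS /stS/forall_inP; exact.
Qed.

(** Two vertices of a clique cannot share a class. *)
Lemma clique_bound P X : proper_coloring P ->
  {in X &, forall x y, x != y -> adj x y} -> #|X| <= #|P|.
Proof.
move=> prP cliX; have /andP[/and3P[/eqP covP _ _] _] := prP.
have mP x : x \in pblock P x by rewrite mem_pblock covP.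
have inP x : pblock P x \in P by rewrite pblock_mem // covP.
rewrite -(card_in_imset (f := pblock P) (D := mem X)).
  by apply/subset_leq_card/subsetP=> _ /imsetP[x _ ->].
move=> x y Xx Xy exy; apply: contraTeq (mP y) => /(cliX _ _ Xx Xy) xy.
apply: contraTN xy; rewrite -exy; exact: class_stable (inP x) (mP x).
Qed.

(** A choice, for each vertex, of one of the classes that it dominates. *)
Definition dominator P (D : G -> {set G}) :=
  forall x, D x \in P /\ {in D x, forall y, adj x y}.

Lemma dominator_exists P : td_coloring P -> exists D, dominator P D.
Proof.
case/andP=> _ /forallP domP.
have {}domP x : exists S, (S \in P) && [forall y in S, adj x y].
  by have /exists_inP[S PS xS] := domP x; exists S; rewrite PS.
exists (fun x => xchoose (domP x)) => x.
by have /andP[PS /forall_inP] := xchooseP (domP x).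
Qed.

(** Vertices of [X] without common neighbors dominate different classes, since a
    class is nonempty, and none of these is the class of [h].  The last
    hypothesis provides a class outside this list of #|X| + 1 classes. *)
Lemma open_packing_bound P D X h :
    proper_coloring P -> dominator P D ->
    {in X &, forall x y z, adj x z -> adj y z -> x = y} ->
    {in X, forall x, ~~ adj x h} ->
    ~ {in P, forall S, h \in S \/ exists2 x, x \in X & S = D x} ->
  #|X| + 2 <= #|P|.
Proof.
move=> prP domD packX farh notall.
have injD : {in X &, injective D}.
  move=> x y Xx Xy eqD; have [PDx Dx] := domD x.
  have [z Dz] := class_nonempty prP PDx.
  by apply: (packX x y Xx Xy z); [exact: Dx | apply: (domD y).2; rewrite -eqD].
have [C PC Ch] := class_exists h prP.
have DC x : x \in X -> D x != C.
  move=> Xx; apply: contraNneq (farh x Xx) => eC.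
  by apply: (domD x).2; rewrite eC.
have /exists_inP[S PS /norP[hS DS]] :
    [exists S in P, ~~ ((h \in S) || (S \in D @: X))].
  apply: contra_notT notall => /exists_inPn allP S /allP; rewrite negbK.
  by case/orP=> [|/imsetP[x Xx ->]]; [left | right; exists x].
rewrite -(card_in_imset injD) -(_ : #|[set C; S]| = 2); last first.
  by rewrite cards2; case: eqVneq hS => // <-; rewrite Ch.
have /eqP <- : #|(D @: X) :|: [set C; S]| == #|D @: X| + #|[set C; S]|.
  rewrite (leq_card_setU _ _).2 -setI_eq0; apply/eqP/setP=> T; rewrite !inE.
  apply/negP=> /andP[/imsetP[x Xx ->]].
  rewrite (negPf (DC x Xx)) /= => /eqP eDS.
  by rewrite -eDS imset_f in DS.
apply/subset_leq_card; rewrite !subUset !sub1set PC PS !andbT.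
by apply/subsetP=> _ /imsetP[x _ ->]; exact: (domD x).1.
Qed.

End TotalDominatorColorings.

(** * Cycles meeting at a vertex, as paths with their ends joined to a hub *)

Section Petals.

Variables q n : nat.

Definition hub : gen_friendship q.+1 n := None.

(** Position [k] on the [i]-th path is the vertex [k.+1] of the [i]-th cycle, so
    that no vertex of a path is the hub. *)
Definition rim (i : 'I_n) (k : 'I_q) : gen_friendship q.+1 n :=
  Some (i, exist (fun x : cycle_graph q.+1 => x != ord0) (lift ord0 k)
             (neq_lift ord0 k : lift ord0 k != ord0)).

(** Lets [case: (vertexP u)] replace an arbitrary vertex by [hub] or [rim i k],
    for which adjacency is given by [adjE]. *)
Variant vertex_spec : gen_friendship q.+1 n -> Prop :=
  | IsHub : vertex_spec hub
  | IsRim i k : vertex_spec (rim i k).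

Lemma vertexP u : vertex_spec u.
Proof.
case: u => [[i [x x0]]|]; last exact: IsHub.
have [k Dx _] : {k | x = lift ord0 k & unlift ord0 x = Some k}.
  by apply: unlift_some; rewrite eq_sym.
suff -> : Some (i, exist _ x x0) = rim i k by exact: IsRim.
by rewrite /rim; congr (Some (i, _)); apply: val_inj.
Qed.

Lemma rim_inj : injective (fun p : 'I_n * 'I_q => rim p.1 p.2).
Proof. by move=> [i k] [j l] [-> /ord_inj ->]. Qed.

Lemma adj_hub : adj hub hub = false. Proof. by []. Qed.

Lemma adj_hub_rim i k : adj hub (rim i k) = (k == 0 :> nat) || (k.+1 == q).
Proof.
have kq := ltn_ord k; have q0 := leq_ltn_trans (leq0n k) kq.
rewrite /= /cycle_adj /= /bump /= add1n modn_small ?ltnS // eqSS.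
congr (_ || _).
have [->|nkq] := eqVneq k.+1 q; first by rewrite modnn.
by rewrite modn_small // ltnS ltn_neqAle nkq kq.
Qed.

Lemma adj_rim_hub i k : adj (rim i k) hub = (k == 0 :> nat) || (k.+1 == q).
Proof. by rewrite adj_sym adj_hub_rim. Qed.

Lemma adj_rim i k j l :
  adj (rim i k) (rim j l) =
  (i == j) && ((l == k.+1 :> nat) || (k == l.+1 :> nat)).
Proof.
rewrite /=; congr (_ && _); rewrite /= /cycle_adj /= /bump /= !add1n.
have succ (a b : 'I_q) : (b.+1 == a.+2 %% q.+1) = (b == a.+1 :> nat).
  have [eaq|naq] := eqVneq a.+1 q; last first.
    by rewrite modn_small // ltnS ltn_neqAle naq ltn_ord.
  by rewrite eaq modnn; apply/esym/negbTE; rewrite neq_ltn ltn_ord.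
(* the condition [i != j] of [cycle_adj] holds because consecutive numbers
   differ *)
rewrite !succ -val_eqE /= /bump /= !add1n eqSS.
by case: eqVneq => // ->; rewrite ltn_eqF.
Qed.

Definition adjE := (adj_hub, adj_hub_rim, adj_rim_hub, adj_rim).

Lemma card_rims (J : finType) (f : J -> 'I_n * 'I_q) : injective f ->
  #|[set rim (f a).1 (f a).2 | a : J]| = #|J|.
Proof. by move=> injf; rewrite card_imset // => a b /rim_inj/injf. Qed.

End Petals.

(** * The three families *)

Lemma td_chromatic_friendship n : 0 < n -> td_chromatic (friendship n) = 3.
Proof.
move=> n0; pose i0 := Ordinal n0.
pose color (u : gen_friendship 3 n) : option bool :=
  if u is Some (i, x) then Some (val (val x) == 1) else None.
rewrite -[RHS](_ : #|{: option bool}| = 3); last first.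
  by rewrite card_option card_bool.
apply: (@td_chromatic_coloring (gen_friendship 3 n) _ color).
- exact: no_isolated_friendship.
- move=> u v; case: (vertexP u) => [|i k]; case: (vertexP v) => [|j l] //.
  rewrite adjE; case: k l => [[|[|k]] ltk] [[|[|l]] ltl] //=; rewrite andbF //.
- move=> u; case: (vertexP u) => [|i k].
    exists (rim i0 ord0) => v; case: (vertexP v) => [|j l] //.
    by case: l => [[|[|l]] ltl] //= _; rewrite adjE.
  exists (hub _ _) => v; case: (vertexP v) => [|j l] // _.
  by case: k => [[|[|k]] ltk] //; rewrite adjE.
- move=> P /andP[prP _].
  pose T := [set hub 2 n; rim i0 ord0; rim i0 ord_max].
  have cT : #|T| = 3 by rewrite /T setUC cardsU1 cards2 !inE.
  rewrite card_option card_bool; apply: leq_trans (clique_bound (X := T) prP _).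
    by rewrite cT.
  move=> x y; rewrite !inE => /orP[/orP[]|] /eqP-> /orP[/orP[]|] /eqP->;
    by rewrite ?eqxx ?adjE.
Qed.

(** The packing consists of the [n] vertices opposite to the hub. *)
Lemma td_chromatic_squares n :
  2 <= n -> td_chromatic (gen_friendship 4 n) = n + 2.
Proof.
move=> n2; pose i0 := Ordinal (ltnW n2); pose i1 := Ordinal n2.
pose mid : 'I_3 := @Ordinal 3 1 isT.
pose color (u : gen_friendship 4 n) : 'I_n + bool :=
  (* [val (val x)] is 2 exactly at position 1, the middle of the path *)
  if u is Some (i, x) then (if val (val x) == 2 then inr false else inl i)
  else inr true.
rewrite -[RHS](_ : #|{: 'I_n + bool}| = n + 2); last first.
  by rewrite card_sum card_ord card_bool.
apply: (@td_chromatic_coloring (gen_friendship 4 n) _ color).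
- exact: (@no_isolated_gen_friendship 4 n isT (ltnW n2)).
- move=> u v; case: (vertexP u) => [|i k]; case: (vertexP v) => [|j l] //.
  + by case: l => [[|[|[|l]]] ltl].
  + by case: k => [[|[|[|k]]] ltk].
  + rewrite adjE; case: k l => [[|[|[|k]]] ltk] [[|[|[|l]]] ltl] //=;
      by rewrite andbF.
- move=> u; case: (vertexP u) => [|i k].
    exists (rim i0 ord0) => v; case: (vertexP v) => [|j l] //.
    by case: l => [[|[|[|l]]] ltl] //= _; rewrite adjE.
  have [->|kmid] := eqVneq k mid.
    exists (rim i ord0) => v; case: (vertexP v) => [|j l] //.
    by rewrite adjE; case: l => [[|[|[|l]]] ltl] //= [->]; rewrite eqxx.
  exists (hub _ _) => v; case: (vertexP v) => [|j l] //.
    by case: k kmid => [[|[|[|k]]] ltk] // _; rewrite adjE.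
  by case: l => [[|[|[|l]]] ltl].
- move=> P tdP; have /andP[prP _] := tdP.
  have [D domD] := dominator_exists tdP.
  pose X := [set rim i mid | i : 'I_n].
  rewrite card_sum card_bool -(_ : #|X| = #|'I_n|); last first.
    by rewrite -(card_rims (f := fun i => (i, mid))) // => i j [].
  apply: (@open_packing_bound _ _ D _ (hub 3 n)) => //.
  + move=> _ _ /imsetP[i _ ->] /imsetP[j _ ->] z.
    by case: (vertexP z) => [|m l]; rewrite !adjE //;
      move=> /andP[/eqP-> _] /andP[/eqP->].
  + by move=> _ /imsetP[i _ ->]; rewrite adjE.
  move=> allP.
  have [C PC hC] := class_exists (hub 3 n) prP.
  (* the classes other than [C] are dominated by middle vertices, and no two of
     these are adjacent *)
  have midC i : rim i mid \in C.
    have [S PS Si] := class_exists (rim i mid) prP.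
    case: (allP S PS) => [hS|[_ /imsetP[j _ ->] eS]].
      by rewrite -(same_class prP PS PC hS hC).
    have := (domD (rim j mid)).2 (rim i mid).
    by rewrite -eS Si adjE andbF => /(_ isT).
  pose a := rim i0 (ord0 : 'I_3); have [PDa Da] := domD a.
  case: (allP _ PDa) => [hDa|[_ /imsetP[j _ ->] eD]].
    have := Da (rim i1 mid); rewrite (same_class prP PDa PC hDa hC) midC adjE.
    by move/(_ isT).
  have [z Dz] := class_nonempty prP PDa.
  have := Da z Dz; have := (domD (rim j mid)).2 z; rewrite -eD => /(_ Dz).
  case: (vertexP z) => [|m l]; rewrite !adjE //.
  by case: l => [[|[|[|l]]] ltl] //; rewrite andbF.
Qed.

(** The packing consists of the [2 * n] vertices at distance 2 from the hub: the
    two on the same cycle are adjacent, but have no common neighbor. *)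
Lemma td_chromatic_pentagons n :
  2 <= n -> td_chromatic (gen_friendship 5 n) = 2 * n + 2.
Proof.
move=> n2; pose i0 := Ordinal (ltnW n2); pose i1 := Ordinal n2.
pose inner (b : bool) : 'I_4 :=
  if b then @Ordinal 4 2 isT else @Ordinal 4 1 isT.
pose color (u : gen_friendship 5 n) : bool * 'I_n + bool :=
  if u is Some (i, x) then
    let k := val (val x) in
    (* position 2 of the path [i0] gets a color of its own, which makes
       position 0 of that path a class inside the neighborhood of the hub *)
    if (i == i0) && (k == 3) then inr true else inl (~~ odd k, i)
  else inr false.
have colorE i k : color (rim i k) =
    if (i == i0) && (k == 2 :> nat) then inr true else inl (odd k, i).
  by rewrite /color /= negbK.
rewrite -[RHS](_ : #|{: bool * 'I_n + bool}| = 2 * n + 2); last first.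
  by rewrite card_sum card_prod card_ord card_bool.
apply: (@td_chromatic_coloring (gen_friendship 5 n) _ color).
- exact: (@no_isolated_gen_friendship 5 n isT (ltnW n2)).
- move=> u v; case: (vertexP u) => [|i k]; case: (vertexP v) => [|j l] //.
  + by rewrite colorE; case: (_ && _).
  + by rewrite colorE; case: (_ && _).
  + rewrite adjE !colorE; case: eqVneq => [->|//].
    by case: k l => [[|[|[|[|k]]]] ltk] [[|[|[|[|l]]]] ltl] //=;
      rewrite ?andbF ?andbT; case: (j == i0).
- move=> u; case: (vertexP u) => [|i k].
    exists (rim i0 ord0) => v; case: (vertexP v) => [|j l] //.
    rewrite adjE !colorE /= ?andbF; case: ifP => // + [ol ji]; rewrite ji eqxx.
    by case: l ol => [[|[|[|[|l]]]] ltl].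
  have [k03|] := boolP ((k == 0 :> nat) || (k.+1 == 4)).
    exists (hub _ _) => v; case: (vertexP v) => [|j l]; rewrite ?adjE //.
    by rewrite colorE; case: (_ && _).
  have [->|k1] := eqVneq k (inner false) => [_|k03].
    exists (rim i ord0) => v; case: (vertexP v) => [|j l].
      by rewrite colorE andbF.
    rewrite adjE !colorE andbF; case: (_ && _) => // -[ol ->].
    by case: l ol => [[|[|[|[|l]]]] ltl]; rewrite ?eqxx.
  exists (rim i ord_max) => v; case: (vertexP v) => [|j l].
    by rewrite colorE andbF.
  rewrite adjE !colorE andbF; case: (_ && _) => // -[ol ->].
  by case: k l k1 k03 ol => [[|[|[|[|k]]]] ltk] [[|[|[|[|l]]]] ltl];
    rewrite ?eqxx.
- move=> P tdP; have /andP[prP _] := tdP.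
  have [D domD] := dominator_exists tdP.
  pose X := [set rim a.2 (inner a.1) | a : bool * 'I_n].
  rewrite card_sum card_bool -(_ : #|X| = #|{: bool * 'I_n}|); last first.
    rewrite -(card_rims (f := fun a => (a.2, inner a.1))) // => -[b i] [c j].
    by case: b c => [] [] // [->].
  apply: (@open_packing_bound _ _ D _ (hub 4 n)) => //.
  + move=> _ _ /imsetP[[b i] _ ->] /imsetP[[c j] _ ->] z.
    case: (vertexP z) => [|m l]; first by case: b.
    rewrite !adjE /= => /andP[/eqP-> bl] /andP[/eqP-> cl]; congr rim.
    by case: b c l bl cl => [] [] [[|[|[|[|l]]]] ltl].
  + by move=> _ /imsetP[[[] i] _ ->]; rewrite adjE.
  move=> allP.
  have [C PC hC] := class_exists (hub 4 n) prP.
  have domI x y : y \in D x -> adj x y by apply: (domD x).2.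
  (* the classes other than [C] are dominated by inner vertices, so a vertex
     that lies in none of those belongs to [C] *)
  have inC u :
      (forall b j, adj (rim j (inner b)) u -> u \notin D (rim j (inner b))) ->
    u \in C.
    move=> far; have [S PS Su] := class_exists u prP.
    case: (allP S PS) => [hS|[_ /imsetP[[b j] _ ->] eS]].
      by rewrite -(same_class prP PS PC hS hC).
    have := far b j; rewrite -eS Su => /(_ (domI _ _ _)).
    by rewrite -eS => /(_ Su).
  (* the witness is the inner neighbor of the inner vertex that dominates the
     same class as the hub *)
  have [i [b Cu]] : exists i b, rim i (inner b) \in C.
    case: (allP _ (domD (hub 4 n)).1) => [/domI|[_ /imsetP[[b i] _ ->] eD]].
      by rewrite adjE.
    exists i, (~~ b); apply: inC => c j; rewrite adjE /= => /andP[/eqP-> bc].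
    have -> : c = b by case: b c bc {eD} => [] [].
    rewrite -eD; apply/negP=> /domI; rewrite adjE; by case: (b).
  have [j ij] : exists j, i != j.
    by have [->|] := eqVneq i i0; [exists i1 | exists i0].
  pose a := rim j (ord0 : 'I_4); have [PDa Da] := domD a.
  case: (allP _ PDa) => [hDa|[_ /imsetP[[c m] _ ->] eD]].
    have := Da (rim i (inner b)).
    by rewrite (same_class prP PDa PC hDa hC) Cu adjE eq_sym (negPf ij) => /(_ isT).
  have [z Dz] := class_nonempty prP PDa.
  have := Da z Dz; have := domI (rim m (inner c)) z; rewrite -eD => /(_ Dz).
  move=> mz az; have [mj ct] : m = j /\ c = true.
    move: mz az; case: (vertexP z) => [|p l]; first by case: (c); rewrite adjE.
    rewrite !adjE /= => /andP[/eqP-> cl] /andP[/eqP-> al]; split=> //.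
    by case: c l cl al {eD} => [] [[|[|[|[|l]]]] ltl].
  (* its only inner neighbor dominates the same class as [a], which is not
     adjacent to it *)
  have : rim j ord_max \in C.
    apply: inC => d p; rewrite adjE => /andP[/eqP-> dl].
    have -> : d = true by case: d dl.
    by rewrite -mj -ct -eD; apply/negP=> /Da; rewrite adjE andbF.
  by move/(class_stable prP PC hC); rewrite adjE.
Qed.

Theorem theorem6 :
  (forall n : nat, 2 <= n -> td_chromatic (friendship n) = 3) /\
  (forall n : nat, 2 <= n -> td_chromatic (gen_friendship 4 n) = n + 2) /\
  (forall n : nat, 2 <= n -> td_chromatic (gen_friendship 5 n) = 2 * n + 2).
Proof.
split; first by move=> n /ltnW; exact: td_chromatic_friendship.
by split; [exact: td_chromatic_squares | exact: td_chromatic_pentagons].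
Qed.
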